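(* Let $p$ be an odd prime and let $n$ be a positive integer. Let $1\le i\le n-1$. Then $|N_i/N_{i-1}|=p^{q_{p,i+1}}$.
   Context: Let $p$ be an odd prime and $n\ge 1$ an integer. For $1\le k\le n$ let $B_k=\mathrm{Fun}(\mathbb{F}_p^{k-1},\mathbb{F}_p)$ (additive group; $B_1=\mathbb{F}_p$). Write $f\Delta_k$ for $f$ regarded as an element of $B_k$, and $\Delta_k$ for the constant function $1$ in $B_k$. The element $f\Delta_k$ acts on $\mathbb{F}_p^n$ as the permutation $x\mapsto x-f(x_1,\dots,x_{k-1})e_k$. $W_n$ is the subgroup of $\mathrm{Sym}(\mathbb{F}_p^n)$ generated by $B_1,\dots,B_n$ (the $n$-fold iterated wreath product of $\mathbb{F}_p$, a Sylow $p$-subgroup of $\mathrm{Sym}(p^n)$). Let $T=\langle\Delta_1,\dots,\Delta_n\rangle\le W_n$ be the canonical elementary abelian regular subgroup (the group of translations of $\mathbb{F}_p^n$). The normalizer chain is $N_{-1}=T$ and $N_i=N_{W_n}(N_{i-1})$ for $i\ge 0$. For $i\ge 1$, $t_{p,i}$ is the number of partitions of $i$ into at least two parts, where each part is repeated at most $p-1$ times, and $q_{p,i}=\sum_{j=1}^{i}t_{p,j}$. *)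

(* Defs.v *)
From HB Require Import structures.
From mathcomp Require Import all_boot all_order all_algebra all_fingroup.

Set Implicit Arguments.
Unset Strict Implicit.
Unset Printing Implicit Defensive.

Import GRing.Theory.

Local Open Scope ring_scope.

(* (x_1, ..., x_n) |-> (x_1, ..., x_(k-1)).  Coordinates are numbered from 0,
   so the informal index k is (k : 'I_n).+1 and the coordinates strictly before
   it are those with index j < k. *)
Definition before p n (k : 'I_n) (x : 'rV['F_p]_n) : 'rV['F_p]_k :=
  \row_(j < k) x 0 (widen_ord (ltnW (ltn_ord k)) j).

Definition base_fun p n (k : 'I_n) (f : {ffun 'rV['F_p]_k -> 'F_p})
    (x : 'rV['F_p]_n) : 'rV['F_p]_n :=
  x - f (before k x) *: delta_mx 0 k.

Lemma before_base_fun p n (k : 'I_n) (f : {ffun 'rV['F_p]_k -> 'F_p}) x :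
  before k (base_fun f x) = before k x.
Proof.
apply/rowP => j; rewrite !mxE eqxx /= -val_eqE /= ltn_eqF ?ltn_ord //.
by rewrite mulr0 subr0.
Qed.

Lemma base_fun_inj p n (k : 'I_n) (f : {ffun 'rV['F_p]_k -> 'F_p}) :
  injective (base_fun f).
Proof.
move=> x y exy; have := congr1 (before k) exy.
by move: exy; rewrite !before_base_fun /base_fun => /[swap] -> /addIr.
Qed.

(* The permutation by which f Delta_k acts. *)
Definition base_perm p n (k : 'I_n) (f : {ffun 'rV['F_p]_k -> 'F_p}) :
    {perm 'rV['F_p]_n} :=
  perm (@base_fun_inj p n k f).

Definition base_set p n (k : 'I_n) : {set {perm 'rV['F_p]_n}} :=
  [set base_perm f | f : {ffun 'rV['F_p]_k -> 'F_p}].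

Definition Delta p n (k : 'I_n) : {perm 'rV['F_p]_n} :=
  base_perm [ffun _ : 'rV['F_p]_k => 1 : 'F_p].

Definition wreath p n : {group {perm 'rV['F_p]_n}} :=
  <<\bigcup_(k < n) base_set p k>>%G.

Definition translations p n : {group {perm 'rV['F_p]_n}} :=
  <<[set Delta p k | k : 'I_n]>>%G.

(* The informal numbering starts at -1: N_(m-1) is normalizer_chain p n m. *)
Fixpoint normalizer_chain p n (m : nat) : {group {perm 'rV['F_p]_n}} :=
  if m is m'.+1 then 'N_(wreath p n)(normalizer_chain p n m')%G
  else translations p n.

Definition is_partition (i : nat) (s : seq nat) : bool :=
  [&& sorted geq s, 0%N \notin s & sumn s == i].

(* A partition of i has at most i parts, each at most i, so it is a bounded
   sequence of type i.-bseq 'I_i.+1; see partition_bseq. *)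
Definition t_num (p i : nat) : nat :=
  #|[set b : i.-bseq 'I_i.+1 |
      let s := [seq val a | a <- b] in
      [&& is_partition i s, (2 <= size s)%N
        & all (fun a => (count_mem a s <= p - 1)%N) s]]|.

Definition q_num (p i : nat) : nat := (\sum_(1 <= j < i.+1) t_num p j)%N.

Lemma partition_bseq (i : nat) (s : seq nat) :
  is_partition i s -> exists b : i.-bseq 'I_i.+1, [seq val a | a <- b] = s.
Proof.
case/and3P => _ s0 /eqP si.
have sz : (size s <= i)%N.
  rewrite -si; elim: s s0 {si} => //= a s IHs; rewrite inE negb_or eq_sym.
  by rewrite -lt0n => /andP[a0 /IHs ss]; rewrite -add1n leq_add.
have sb a : a \in s -> (a < i.+1)%N.
  by move=> as_; rewrite ltnS -si (perm_sumn (perm_to_rem as_)) /= leq_addr.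
have sz' : (size [seq inord a : 'I_i.+1 | a <- s] <= i)%N by rewrite size_map.
exists (Bseq sz') => /=; rewrite -map_comp -[RHS]map_id.
by apply/eq_in_map => a /sb ai /=; rewrite inordK.
Qed.

(* Main.v *)
From HB Require Import structures.
From mathcomp Require Import all_boot all_order all_algebra all_fingroup.
From mathcomp Require Import zify ring.
Require Import Defs.

Set Implicit Arguments.
Unset Strict Implicit.
Unset Printing Implicit Defensive.

Import GRing.Theory.

(** Write an element of the wreath product as a map x |-> x + f(x), where the
    component f_k depends on the coordinates before the k-th only.  Give the
    coordinate of index j the weight j + 1; a function on (F_p)^n then has a
    weight, that of its heaviest monomial.  The claim behind the theorem is that
    for 0 < m <= n the m-th group of the chain (counted from the translations,
    which are the 0-th) consists of the maps whose component f_k has weight at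
    most m + (k + 1) - n up to an affine function, for each index k
    ([normalizer_chain_level]).

    The weight is controlled by finite differences.  On the products of binomial
    coefficients C(x_j, L_j), with exponents less than p, the difference along
    the j-th axis lowers one exponent by one, so that for w > 0 a function has weight
    less than w if and only if its differences along each axis j have weight less
    than w - (j + 1) ([diff_wlt], [wlt_diff]).  From this Leibniz' rule gives
    that weights add up under products, and hence that substituting a map which
    raises no weight raises no weight ([wlt_pull]), and that substituting a
    map whose displacements are lighter than the coordinates which they move
    changes functions by lighter ones ([wlt_pullB]).  So the sets in the claim
    are groups, and each normalizes the one before ([level_group_set],
    [level_norm]).

    The normalizer of the translations is affine ([normalizer_translations]).
    Let s normalize the m-th group for some m > 0.  If the k-th
    coordinate is not the last, conjugating the shear which adds x_k to x_(k+1)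
    by the inverse of s gives a map whose (k+1)-st displacement is the k-th
    coordinate of s itself, so that f_k is in the space allowed for k + 1
    ([normalizer_level_lt]); this is the space wanted for k at the next step.
    For the last component the conjugates of the translations and of the shears
    show that its differences, and its change under each shear from a
    coordinate to the next, are affine up to weight m.  Differences along the
    first axis are too heavy only if they contain a linear term, and this is
    excluded because 2 is invertible ([diff_first_wlt]); the other axes follow,
    as the translation along an axis is a commutator of the preceding
    translation with a shear ([affine_wle_succ]).

    The Newton coefficients of the components are free parameters, so that the
    order of each group is p to the number of exponents which are allowed
    ([card_level]).  The exponents gained at the step from m to m + 1 have at
    least two factors, their weight w is at most m + 1, and w determines the
    component in which they occur ([card_level_exps]).  Exponents of weight w
    with at least two factors are partitions of w into at least two parts, each
    repeated less than p times: the multiplicity of the part j + 1 is the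
    exponent of x_j ([t_numE]). *)

Local Open Scope ring_scope.

(** * Binomial coefficients in a prime field *)

Section PrimeField.

Variables (p : nat) (p_prime : prime p).

Lemma ltn_Fp (a : 'F_p) : (a < p)%N.
Proof. by rewrite -{2}(Fp_cast p_prime). Qed.

Lemma nat_of_Fp (m : nat) : nat_of_ord (m%:R : 'F_p) = (m %% p)%N.
Proof. by rewrite (val_Fp_nat p_prime). Qed.

Lemma Fp_natr (a : 'F_p) : (nat_of_ord a)%:R = a.
Proof. exact: natr_Zp. Qed.

Lemma Fp_p0 : p%:R = 0 :> 'F_p.
Proof. by apply: ord_inj; rewrite nat_of_Fp modnn. Qed.

Lemma Fp_eq0 (a : 'F_p) : (a == 0) = (nat_of_ord a == 0%N).
Proof. by rewrite -val_eqE. Qed.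

Lemma Fp_subr1 (a : 'F_p) : a != 0 -> nat_of_ord (a - 1) = (nat_of_ord a).-1.
Proof.
move=> a0; have : (0 < nat_of_ord a)%N by rewrite lt0n -Fp_eq0.
move=> a_gt0; rewrite -{1}(Fp_natr a) -[1]/(1%:R) -natrB // nat_of_Fp subn1 modn_small //.
exact: leq_ltn_trans (leq_pred _) (ltn_Fp a).
Qed.

Lemma Fp_addr1 (a : 'F_p) : a != -1 -> nat_of_ord (a + 1) = (nat_of_ord a).+1.
Proof.
move=> a1; have a0 : a + 1 != 0 by rewrite addr_eq0.
rewrite -{2}[a](addrK 1) (Fp_subr1 a0) prednK //.
by rewrite lt0n -Fp_eq0.
Qed.

(** Pascal's rule survives reduction of the argument modulo [p], because the
    entry C(p, a) which is lost on wrapping around is divisible by [p]. *)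
Lemma bin_Fp_diff (x a : 'F_p) : a != 0 ->
  'C((x + 1)%R : 'F_p, a)%:R - 'C(x, a)%:R = 'C(x, (a - 1)%R : 'F_p)%:R :> 'F_p.
Proof.
move=> a0; rewrite (Fp_subr1 a0).
have [b a_def] : exists b, nat_of_ord a = b.+1.
  by exists (nat_of_ord a).-1; rewrite prednK // lt0n -Fp_eq0.
rewrite a_def -pred_Sn; have [-> | x1] := eqVneq x (-1); last first.
  by rewrite (Fp_addr1 x1) binS natrD addrAC subrr add0r.
rewrite addNr bin0n sub0r; apply/eqP.
have p_gt0 := prime_gt0 p_prime.
have -> : nat_of_ord (-1 : 'F_p) = p.-1.
  have -> : -1 = p.-1%:R :> 'F_p.
    by apply/eqP; rewrite eq_sym -addr_eq0 natr1 prednK // Fp_p0.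
  by rewrite nat_of_Fp modn_small // prednK.
rewrite eq_sym -subr_eq0 opprK -natrD addnC -binS prednK //.
rewrite Fp_eq0 nat_of_Fp; apply: prime_dvd_bin => //=.
by rewrite -a_def ltn_Fp.
Qed.

End PrimeField.

(** * Newton expansions *)

Section Newton.

Variables (p : nat) (p_prime : prime p) (n : nat).

Local Notation R := 'F_p.
Local Notation V := 'rV['F_p]_n.
Local Notation fn := {ffun V -> 'F_p}.

Implicit Types (S : pred V) (f g : fn) (L M x y : V) (i j k : 'I_n) (w : nat).

Lemma ffunM f g x : (f * g) x = f x * g x.
Proof. by rewrite /GRing.mul /= ffunE. Qed.

Definition axis j : V := delta_mx 0 j.

Lemma axisE j k : axis j 0 k = (k == j)%:R.
Proof. by rewrite mxE eqxx. Qed.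

(** Unlike monomials, these products are permuted up to zero by the difference
    operators.  Exponents are less than [p], so that a row of exponents is
    encoded as a point of the space; this also makes the number of exponents
    equal to the number of points. *)
Definition binom L : fn := [ffun x : V => \prod_j 'C(x 0 j, L 0 j)%:R].

Definition diff j f : fn := [ffun x => f (x + axis j) - f x].

Definition newton (c : fn) : fn := [ffun x => \sum_L c L * binom L x].

Definition size_exp L : nat := \sum_j nat_of_ord (L 0%R j).

Lemma newtonB c d : newton (c - d) = newton c - newton d.
Proof.
apply/ffunP => x; rewrite !ffunE -sumrB; apply: eq_bigr => L _.
by rewrite !ffunE mulrBl.
Qed.

(** The matrix of values C(M, L), where M is a point and L a row of exponents,
    is unitriangular for the componentwise order. *)
Lemma newton_inj : injective newton.
Proof.
move=> c d /eqP; rewrite -subr_eq0 -newtonB => /eqP e0.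
apply/eqP; rewrite -subr_eq0; apply/negPn/negP => /eqP ne0.
move: (c - d) e0 ne0 => {d} {}c e0 ne0; apply: ne0; apply/ffunP => L.
rewrite [RHS]ffunE; have [s] := ubnP (size_exp L).
elim: s L => // s IHs L; rewrite ltnS => Ls.
have /ffunP/(_ L) := e0; rewrite !ffunE (bigD1 L) //=.
rewrite ffunE big1 ?mulr1 => [|j _]; last by rewrite binn.
rewrite big1 ?addr0 // => M ML; rewrite ffunE.
have [/forallP le_ML | ] := boolP [forall j, (M 0%R j <= L 0%R j)%N]; last first.
  rewrite negb_forall => /existsP[j]; rewrite -ltnNge => lt_LM.
  by rewrite (bigD1 j) //= bin_small // mul0r mulr0.
rewrite (IHs M) ?mul0r //; apply: leq_trans Ls.
rewrite /size_exp [ltnLHS]big_mkcond [ltnRHS]big_mkcond.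
have [j ne_j] : exists j, M 0 j != L 0 j.
  apply/existsP; rewrite -negb_forall; apply: contra ML => /forallP eq_ML.
  by apply/eqP/rowP => j; apply/eqP.
rewrite (bigD1 j) //= [ltnRHS](bigD1 j) //= -addSn leq_add //; last exact: leq_sum.
by rewrite ltn_neqAle le_ML andbT -val_eqE in ne_j *.
Qed.

(** An injective map of a finite set to itself is bijective, so that every
    function has a unique Newton expansion. *)
Definition coef f : fn := invF newton_inj f.

Lemma newtonK : cancel newton coef.
Proof. exact: invF_f. Qed.

Lemma coefK : cancel coef newton.
Proof. exact: f_invF. Qed.

Lemma coefE f x : f x = \sum_L coef f L * binom L x.
Proof. by rewrite -{1}[f]coefK ffunE. Qed.

Lemma coefB f g : coef (f - g) = coef f - coef g.
Proof. by apply: newton_inj; rewrite newtonB !coefK. Qed.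

Lemma coef0 : coef 0 = 0.
Proof. by have := coefB 0 0; rewrite !subrr. Qed.

Lemma coefD f g : coef (f + g) = coef f + coef g.
Proof.
have coefN h : coef (- h) = - coef h by rewrite -sub0r coefB coef0 sub0r.
by rewrite -[g]opprK coefB !coefN opprK.
Qed.

Lemma coefZ a f : coef ([ffun=> a] * f) = [ffun=> a] * coef f.
Proof.
apply: newton_inj; rewrite coefK; apply/ffunP => x.
rewrite ffunM ffunE (coefE f) mulr_sumr ffunE; apply: eq_bigr => L _.
by rewrite ffunM [X in X * _ * _]ffunE mulrA.
Qed.

Lemma coef_binom L M : coef (binom L) M = (M == L)%:R.
Proof.
suff -> : binom L = newton [ffun M' => (M' == L)%:R] by rewrite newtonK ffunE.
apply/ffunP => x; rewrite [RHS]ffunE (bigD1 L) //= [X in X * _ + _]ffunE eqxx mul1r.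
by rewrite big1 ?addr0 // => K /negPf KL; rewrite [X in X * _]ffunE KL mul0r.
Qed.

(** Pascal's rule in the [j]-th variable. *)
Lemma diff_binom j L x :
  diff j (binom L) x = (L 0 j != 0)%:R * binom (L - axis j) x.
Proof.
rewrite !ffunE (bigD1 j) //= [X in _ - X](bigD1 j) //= [in RHS](bigD1 j) //=.
rewrite !mxE !eqxx /=.
have -> : \prod_(i < n | i != j) 'C((x + axis j)%R 0%R i, L 0%R i)%:R =
    \prod_(i < n | i != j) 'C(x 0%R i, L 0%R i)%:R :> 'F_p.
  apply: eq_bigr => i ij; rewrite mxE axisE (negPf ij) addr0 //.
have -> : \prod_(i < n | i != j) 'C(x 0%R i, (L - axis j)%R 0%R i)%:R =
    \prod_(i < n | i != j) 'C(x 0%R i, L 0%R i)%:R :> 'F_p.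
  apply: eq_bigr => i ij; rewrite 2!mxE axisE (negPf ij) subr0 //.
rewrite -mulrBl; have [-> | L0] := eqVneq (L 0 j) 0.
  by rewrite !bin0 subrr !mul0r.
by rewrite mul1r (bin_Fp_diff p_prime).
Qed.

Lemma coef_diff j f M :
  coef (diff j f) M = (M 0 j != -1)%:R * coef f (M + axis j).
Proof.
suff -> : diff j f = newton [ffun M : V => (M 0 j != -1)%:R * coef f (M + axis j)].
  by rewrite newtonK ffunE.
apply/ffunP => x; rewrite [RHS]ffunE.
rewrite [LHS]ffunE !(coefE f) -sumrB (reindex_inj (addIr (axis j))) /=.
apply: eq_bigr => L _; have := diff_binom j (L + axis j) x.
rewrite [LHS]ffunE addrK mxE axisE eqxx -mulrBr => ->.
by rewrite [X in _ = X * _]ffunE addr_eq0 mulrCA mulrA.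
Qed.


(** * Weights *)

Definition weight L : nat := \sum_(j < n) (j.+1 * L 0%R j)%N.

Lemma exp_add1 (h : 'I_n -> nat) M j : M 0 j != -1 ->
  (\sum_i h i * (M + axis j)%R 0%R i = (\sum_i h i * M 0%R i) + h j)%N.
Proof.
move=> Mj; rewrite (bigD1 j) //= [in RHS](bigD1 j) //= mxE axisE eqxx.
rewrite (Fp_addr1 p_prime Mj) mulnS [(h j + _)%N]addnC -!addnA; congr addn.
rewrite addnC; congr addn; apply: eq_bigr => i /negPf ij.
by rewrite mxE axisE ij addr0.
Qed.

Lemma weight_add1 M j : M 0 j != -1 -> weight (M + axis j) = (weight M + j.+1)%N.
Proof. exact: exp_add1. Qed.

Lemma size_exp_add1 M j : M 0 j != -1 -> size_exp (M + axis j) = (size_exp M).+1.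
Proof.
have E L : size_exp L = (\sum_i 1 * L 0%R i)%N.
  by apply: eq_bigr => i _; rewrite mul1n.
by move=> Mj; rewrite !E exp_add1 // addn1.
Qed.

Lemma exp_neq0 L : L != 0 -> exists j, L 0 j != 0.
Proof. by move=> /rV0Pn. Qed.

Lemma exp_sub1 L j : L 0 j != 0 -> (L - axis j) 0 j != -1.
Proof. by move=> L0; rewrite 2!mxE axisE eqxx subr_eq addNr. Qed.

Lemma size_exp0 : size_exp 0 = 0%N.
Proof. by rewrite /size_exp big1 // => j _; rewrite mxE. Qed.

Lemma weight0 : weight 0 = 0%N.
Proof. by rewrite /weight big1 // => j _; rewrite mxE muln0. Qed.

Lemma size_exp_eq0 L : (size_exp L == 0%N) = (L == 0).
Proof.
apply/idP/eqP => [|->]; last by rewrite size_exp0.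
apply: contraTeq => /exp_neq0[j Lj]; rewrite -lt0n /size_exp (bigD1 j) //=.
by rewrite addn_gt0 lt0n -Fp_eq0 Lj.
Qed.

Lemma size_exp_le1 L : (size_exp L <= 1)%N -> L = 0 \/ exists j, L = axis j.
Proof.
have [-> | L0] := eqVneq L 0; [by left | right].
have [j Lj] := exp_neq0 L0; exists j; apply/eqP; rewrite -subr_eq0.
rewrite -size_exp_eq0 -leqn0 -ltnS -(@size_exp_add1 _ j) ?exp_sub1 //.
by rewrite subrK.
Qed.

Lemma axis_neqN1 j : (0 : V) 0 j != -1.
Proof. by rewrite mxE eq_sym oppr_eq0 oner_eq0. Qed.

Lemma weight_axis j : weight (axis j) = j.+1.
Proof. by rewrite -[axis j]add0r weight_add1 ?axis_neqN1 // weight0. Qed.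

Lemma size_exp_axis j : size_exp (axis j) = 1%N.
Proof. by rewrite -[axis j]add0r size_exp_add1 ?axis_neqN1 // size_exp0. Qed.

(** * Functions with prescribed Newton coefficients *)

Definition supported (S : pred V) f : bool :=
  [forall L, (coef f L != 0) ==> S L].

Lemma supportedP S f :
  reflect (forall L, coef f L != 0 -> S L) (supported S f).
Proof. by apply: (iffP forallP) => H L; have /implyP := H L. Qed.

Lemma supported_sub S S' f :
  (forall L, S L -> S' L) -> supported S f -> supported S' f.
Proof. by move=> SS /supportedP Sf; apply/supportedP => L /Sf /SS. Qed.

Lemma supportedI S S' f :
  supported (fun L => S L && S' L) f = supported S f && supported S' f.
Proof.
apply/supportedP/andP => [H | [/supportedP H /supportedP H'] L Lf].
  by split; apply/supportedP => L /H /andP[].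
by rewrite H // H'.
Qed.

Lemma supported0 S : supported S 0.
Proof. by apply/supportedP => L; rewrite coef0 ffunE eqxx. Qed.

Lemma supportedD S f g : supported S f -> supported S g -> supported S (f + g).
Proof.
move=> /supportedP Sf /supportedP Sg; apply/supportedP => L.
rewrite coefD ffunE; have [-> | /Sf //] := eqVneq (coef f L) 0.
by rewrite add0r => /Sg.
Qed.

Lemma supportedN S f : supported S f -> supported S (- f).
Proof.
move=> /supportedP Sf; apply/supportedP => L.
by rewrite -sub0r coefB coef0 !ffunE sub0r oppr_eq0 => /Sf.
Qed.

Lemma supportedB S f g : supported S f -> supported S g -> supported S (f - g).
Proof. by move=> Sf /supportedN; apply: supportedD. Qed.

Lemma supportedZ S a f : supported S f -> supported S ([ffun=> a] * f).
Proof.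
move=> /supportedP Sf; apply/supportedP => L; rewrite coefZ ffunM mulf_eq0.
by rewrite negb_or => /andP[_ /Sf].
Qed.

Lemma supported_binom (S : pred V) L : S L -> supported S (binom L).
Proof.
move=> SL; apply/supportedP => M; rewrite coef_binom.
by case: (eqVneq M L) => [->|_] //; rewrite eqxx.
Qed.

Lemma newton_sum f : f = \sum_L [ffun=> coef f L] * binom L.
Proof.
apply/ffunP => x; rewrite sum_ffunE coefE; apply: eq_bigr => L _.
by rewrite ffunM [X in _ = X * _]ffunE.
Qed.

Lemma supported_ind (S : pred V) (K : fn -> Prop) :
    K 0 -> (forall f g, K f -> K g -> K (f + g)) ->
    (forall a f, K f -> K ([ffun=> a] * f)) ->
    (forall L, S L -> K (binom L)) ->
  forall f, supported S f -> K f.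
Proof.
move=> K0 KD KZ KS f /supportedP Sf; rewrite [f]newton_sum.
apply: (big_ind K) => // L _; have [-> | /Sf/KS/KZ//] := eqVneq (coef f L) 0.
by have -> : [ffun=> 0] * binom L = 0 by apply/ffunP => x; rewrite ffunM !ffunE mul0r.
Qed.

Lemma coef_diff_neq0 j f M : coef (diff j f) M != 0 ->
  M 0 j != -1 /\ coef f (M + axis j) != 0.
Proof.
rewrite coef_diff; have [_ | Mj] := eqVneq (M 0 j) (-1).
  by rewrite mul0r eqxx.
by rewrite mul1r.
Qed.

Lemma coef_diff_sub1 j f L : L 0 j != 0 ->
  coef (diff j f) (L - axis j) = coef f L.
Proof. by move=> L0; rewrite coef_diff exp_sub1 // mul1r subrK. Qed.

Definition exp_before (k : nat) : pred V :=
  fun L => [forall j : 'I_n, (k <= j)%N ==> (L 0 j == 0)].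

Lemma exp_beforeP (k : nat) L :
  reflect (forall j : 'I_n, (k <= j)%N -> L 0 j = 0) (exp_before k L).
Proof.
apply: (iffP forallP) => H j; first by move=> kj; have /implyP/(_ kj)/eqP := H j.
by apply/implyP => /H/eqP.
Qed.

(** A function depends on the first [k] coordinates only if its differences
    along the other axes vanish, hence all coefficients of exponents which
    involve these axes. *)
Lemma supported_beforeP (k : nat) f :
  reflect (forall x y, (forall j : 'I_n, (j < k)%N -> x 0 j = y 0 j) -> f x = f y)
    (supported (exp_before k) f).
Proof.
apply: (iffP idP) => [kf x y xy | kf].
  rewrite !(coefE f); apply: eq_bigr => L _.
  have [-> | /(elimT (supportedP _ _) kf)/exp_beforeP Lk] := eqVneq (coef f L) 0.
    by rewrite !mul0r.
  rewrite !ffunE; congr (_ * _); apply: eq_bigr => j _.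
  by have [/xy-> // | /Lk->] := ltnP j k; rewrite !bin0.
apply/supportedP => L Lf; apply/exp_beforeP => j kj; apply/eqP.
apply: contraNT Lf => /(coef_diff_sub1 f) <-.
suff -> : diff j f = 0 by rewrite coef0 ffunE.
apply/ffunP => x; rewrite !ffunE; apply/eqP; rewrite subr_eq0; apply/eqP.
apply: kf => i ik; rewrite mxE axisE -val_eqE /= ltn_eqF ?addr0 //.
exact: leq_trans kj.
Qed.

(** * The filtration by weight *)

Definition wlt w f : bool := supported (fun L => (weight L < w)%N) f.

Lemma wlt_sub w w' f : (w <= w')%N -> wlt w f -> wlt w' f.
Proof. by move=> ww; apply: supported_sub => L /leq_trans->. Qed.

Lemma wlt0 f : wlt 0 f -> f = 0.
Proof.
move=> /supportedP f0; rewrite [f]newton_sum big1 // => L _.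
have /eqP -> : coef f L == 0 by apply: contraT => /f0.
by apply/ffunP => x; rewrite ffunM !ffunE mul0r.
Qed.

Lemma diff_wlt w j f : wlt w f -> wlt (w - j.+1) (diff j f).
Proof.
move=> /supportedP wf; apply/supportedP => M /coef_diff_neq0[Mj /wf].
by rewrite weight_add1 //; lia.
Qed.

(** Together with [diff_wlt] this characterizes the filtration by differences.
    The truncated subtraction is meant: the differences along the axes of weight
    at least [w.+1] have to vanish. *)
Lemma wlt_diff w f : (forall j, wlt (w.+1 - j.+1) (diff j f)) -> wlt w.+1 f.
Proof.
move=> wf; apply/supportedP => L Lf.
have [-> | /exp_neq0[j Lj]] := eqVneq L 0; first by rewrite weight0.
have /supportedP/(_ (L - axis j)) := wf j; rewrite coef_diff_sub1 // => /(_ Lf).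
by have := weight_add1 (exp_sub1 Lj); rewrite subrK; lia.
Qed.

Lemma wlt_const w a : wlt w.+1 [ffun=> a].
Proof.
apply: wlt_diff => j; suff -> : diff j [ffun=> a] = 0 by apply: supported0.
by apply/ffunP => x; rewrite !ffunE subrr.
Qed.

Lemma wlt1P f : reflect (forall x y, f x = f y) (wlt 1 f).
Proof.
apply: (iffP idP) => [f1 x y | f_const]; last first.
  have -> : f = [ffun=> f 0] by apply/ffunP => x; rewrite ffunE; apply: f_const.
  exact: wlt_const.
apply: (@supported_beforeP 0 f) => //; apply: supported_sub f1 => L.
rewrite ltnS leqn0 => /eqP L0; apply/exp_beforeP => j _; apply/eqP.
apply: contraT => Lj; move: L0.
by rewrite -[L](subrK (axis j)) weight_add1 ?exp_sub1 // addnS.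
Qed.

Lemma diffM j f g :
  diff j (f * g) = diff j f * g + f * diff j g + diff j f * diff j g.
Proof.
apply/ffunP => x; rewrite [LHS]ffunE; do 2 rewrite [in RHS]ffunE; rewrite !ffunM.
by rewrite ![diff _ _ _]ffunE; ring.
Qed.

(** Leibniz' rule makes weights subadditive; the reduction of exponents
    modulo x^p = x is thereby never needed. *)
Lemma wltM a b f g : wlt a f -> wlt b g -> wlt (a + b).-1 (f * g).
Proof.
have [N] := ubnP (a + b); elim: N a b f g => // N IHN [|a] [|b] f g ab fa gb.
- by rewrite (wlt0 fa) mul0r; apply: supported0.
- by rewrite (wlt0 fa) mul0r; apply: supported0.
- by rewrite (wlt0 gb) mulr0; apply: supported0.
have mulF c d f' g' : (c + d < N)%N -> wlt c f' -> wlt d g' ->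
    wlt (if (c == 0%N) || (d == 0%N) then 0%N else (c + d).-1) (f' * g').
  move=> cd fc gd; case: eqP => [c0 | _].
    by move: fc; rewrite c0 => /wlt0->; rewrite mul0r; apply: supported0.
  case: eqP => [d0 | _]; last exact: IHN.
  by move: gd; rewrite d0 => /wlt0->; rewrite mulr0; apply: supported0.
rewrite addSn addnS; apply: wlt_diff => j; rewrite diffM.
have fj := diff_wlt j fa; have gj := diff_wlt j gb.
apply: supportedD; first apply: supportedD.
- by apply: wlt_sub (mulF _ _ _ _ _ fj gb); [case: ifP|]; lia.
- by apply: wlt_sub (mulF _ _ _ _ _ fa gj); [case: ifP|]; lia.
- by apply: wlt_sub (mulF _ _ _ _ _ fj gj); [case: ifP|]; lia.
Qed.


(** * Substitution and weights *)

Definition coord j : fn := [ffun x : V => x 0 j].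

Definition pull (s : V -> V) f : fn := [ffun x => f (s x)].

Lemma binom_axis j : binom (axis j) = coord j.
Proof.
apply/ffunP => x; rewrite !ffunE (bigD1 j) //= big1 ?mulr1 => [|i /negPf ij].
  by rewrite axisE eqxx bin1 Fp_natr.
by rewrite axisE ij bin0.
Qed.

Lemma binS_Fp (x : 'F_p) a : (a.+1 < p)%N ->
  'C(x, a.+1)%:R = a.+1%:R^-1 * ('C(x, a)%:R * (x - a%:R)) :> 'F_p.
Proof.
move=> a_lt_p; have a0 : a.+1%:R != 0 :> 'F_p.
  by rewrite Fp_eq0 (nat_of_Fp p_prime) modn_small.
apply: (mulfI a0); rewrite mulVKf // -natrM mul_bin_left natrM mulrC.
have [ax | xa] := leqP a x; first by rewrite natrB // Fp_natr.
by rewrite bin_small // !mul0r.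
Qed.

(** Binomial coefficients are polynomials in the coordinates, as a factorial of
    a number less than [p] is invertible; thus a property compatible with the
    weights need only be checked on coordinates, sums and products. *)
Lemma wlt_ind (k : nat) (K : nat -> fn -> Prop) :
    (forall w, K w 0) -> (forall w f g, K w f -> K w g -> K w (f + g)) ->
    (forall w a f, K w f -> K w ([ffun=> a] * f)) ->
    (forall v w f, (v <= w)%N -> K v f -> K w f) -> K 1%N [ffun=> 1] ->
    (forall j, (j < k)%N -> K j.+2 (coord j)) ->
    (forall v w f g, K v.+1 f -> K w.+1 g -> K (v + w).+1 (f * g)) ->
  forall w f, wlt w f -> supported (exp_before k) f -> K w f.
Proof.
move=> K0 KD KZ Kle K1 KX KM w f wf kf.
have : supported (fun L => (weight L < w)%N && exp_before k L) f.
  by rewrite supportedI; apply/andP.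
apply: supported_ind => // [g h|a g|L /andP[Lw Lk]]; [exact: KD|exact: KZ|].
apply: (Kle) Lw _.
have KC w' a : K w'.+1 [ffun=> a].
  have -> : [ffun=> a] = [ffun=> a] * [ffun=> 1] :> fn.
    by apply/ffunP => x; rewrite ffunM !ffunE mulr1.
  by apply: KZ; apply: (Kle) K1.
have Kbin j a : (j < k)%N -> (a < p)%N ->
    K (j.+1 * a).+1 [ffun x : V => 'C(x 0%R j, a)%:R].
  move=> jk; elim: a => [_|a IHa ap].
    have -> : [ffun x : V => 'C(x 0%R j, 0)%:R] = [ffun=> 1] :> fn; last exact: KC.
    by apply/ffunP => x; rewrite !ffunE bin0.
  have -> : [ffun x : V => 'C(x 0%R j, a.+1)%:R] =
    [ffun=> a.+1%:R^-1] *
      ([ffun x : V => 'C(x 0%R j, a)%:R] * (coord j + [ffun=> - a%:R])).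
    by apply/ffunP => x; rewrite !ffunM !ffunE binS_Fp.
  rewrite mulnS addnC; apply/KZ/KM; first by apply: IHa; apply: ltnW.
  by apply: KD; [apply: KX | apply: KC].
rewrite /weight /binom; elim: (index_enum _) => [|j r IHr].
  rewrite big_nil; have -> : [ffun x : V => \prod_(i <- [::]) 'C(x 0%R i, L 0%R i)%:R]
    = [ffun=> 1] :> fn; last exact: KC.
  by apply/ffunP => x; rewrite !ffunE big_nil.
rewrite big_cons.
have -> : [ffun x : V => \prod_(i <- j :: r) 'C(x 0%R i, L 0%R i)%:R] =
  [ffun x : V => 'C(x 0%R j, L 0%R j)%:R] *
    [ffun x : V => \prod_(i <- r) 'C(x 0%R i, L 0%R i)%:R] :> fn.
  by apply/ffunP => x; rewrite ffunM !ffunE big_cons.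
apply: KM IHr; have [jk | kj] := ltnP j k; first exact/Kbin/ltn_Fp.
have -> : [ffun x : V => 'C(x 0%R j, L 0%R j)%:R] = [ffun=> 1] :> fn.
  by apply/ffunP => x; move/exp_beforeP: Lk => ->; rewrite // !ffunE bin0.
exact: KC.
Qed.

Lemma pullD s f g : pull s (f + g) = pull s f + pull s g.
Proof. by apply/ffunP => x; rewrite !ffunE. Qed.

Lemma pullM s f g : pull s (f * g) = pull s f * pull s g.
Proof. by apply/ffunP => x; rewrite ffunM !ffunE. Qed.

Lemma pull_const s a : pull s [ffun=> a] = [ffun=> a].
Proof. by apply/ffunP => x; rewrite !ffunE. Qed.

Lemma pull0 s : pull s 0 = 0.
Proof. by apply/ffunP => x; rewrite !ffunE. Qed.

Lemma wlt_pull (k : nat) s w f :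
    (forall j, (j < k)%N -> wlt j.+2 (pull s (coord j))) ->
  supported (exp_before k) f -> wlt w f -> wlt w (pull s f).
Proof.
move=> sX kf wf; move: w f wf kf.
apply: wlt_ind => [w|w f g|w a f|v w f|||v w f g] //.
- by rewrite pull0; apply: supported0.
- by rewrite pullD; apply: supportedD.
- by rewrite pullM pull_const; apply: supportedZ.
- exact: wlt_sub.
- by rewrite pull_const; apply: wlt_const.
- by rewrite pullM => fv gw; have := wltM fv gw; rewrite addSn addnS.
Qed.

Lemma wlt_coord j : wlt j.+2 (coord j).
Proof. by rewrite -binom_axis; apply: supported_binom; rewrite weight_axis. Qed.

Lemma exp_beforeT (k : nat) f : (n <= k)%N -> supported (exp_before k) f.
Proof.
move=> nk; apply/supportedP => L _; apply/exp_beforeP => j.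
by move/(leq_trans nk); rewrite leqNgt ltn_ord.
Qed.

(** The case of a product follows from
    (g + g')(h + h') - g h = g' h' + g' h + g h',
    each term of which contains a lighter factor. *)
Lemma wlt_pullB s w f :
    (forall j, wlt j.+1 (pull s (coord j) - coord j)) ->
  wlt w f -> wlt w.-1 (pull s f - f).
Proof.
move=> sX; pose K w f := wlt w f /\ wlt w.-1 (pull s f - f).
suff KP w' f' : wlt w' f' -> supported (exp_before n) f' -> K w' f'.
  by move=> wf; have [] := KP w f wf (exp_beforeT f (leqnn n)).
move: w' f'; apply: wlt_ind => [u|u g h|u a g|v u g uv|||v u g h].
- by split; rewrite ?pull0 ?subrr; apply: supported0.
- move=> [ug ug'] [uh uh']; split; first exact: supportedD.
  by rewrite pullD opprD addrACA; apply: supportedD.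
- move=> [ug ug']; split; first exact: supportedZ.
  by rewrite pullM pull_const -mulrBr; apply: supportedZ.
- move=> [vg vg']; split; first exact: wlt_sub vg.
  by apply: wlt_sub vg'; lia.
- by split; [apply: wlt_const | rewrite pull_const subrr; apply: supported0].
- by move=> j _; split; [apply: wlt_coord | apply: sX].
move=> [vg vg'] [uh uh']; split; first by have := wltM vg uh; rewrite addSn addnS.
have -> : pull s (g * h) - g * h =
    (pull s g - g) * (pull s h - h) + (pull s g - g) * h + g * (pull s h - h).
  by apply/ffunP => x; rewrite pullM !(ffunE, ffunM); ring.
apply: supportedD; first apply: supportedD.
- by apply: wlt_sub (wltM vg' uh'); lia.
- by apply: wlt_sub (wltM vg' uh); lia.
- by apply: wlt_sub (wltM vg uh'); lia.
Qed.

(** * Affine functions and weights *)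

(** The affine functions plus the functions of weight at most [w]. *)
Definition affine_wle w f : bool :=
  supported (fun L => (weight L <= w)%N || (size_exp L <= 1)%N) f.

Lemma affine_wle_sub w w' f : (w <= w')%N -> affine_wle w f -> affine_wle w' f.
Proof.
move=> ww; apply: supported_sub => L.
by case/orP => [/leq_trans-> // | ->]; rewrite orbT.
Qed.

Lemma affine_wleD w f g :
  affine_wle w f -> affine_wle w g -> affine_wle w (f + g).
Proof. exact: supportedD. Qed.

Lemma wlt_affine w f : wlt w.+1 f -> affine_wle w f.
Proof. by apply: supported_sub => L; rewrite ltnS => ->. Qed.

Lemma affine_wle_coord w j : affine_wle w (coord j).
Proof.
by rewrite -binom_axis; apply: supported_binom; rewrite size_exp_axis orbT.
Qed.

Lemma size_exp_le_weight L : (size_exp L <= weight L)%N.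
Proof. by apply: leq_sum => j _; rewrite leq_pmull. Qed.

(** The analogue for [affine_wle] of the characterization of the weight by
    differences: the differences along heavy axes may now be constant. *)
Lemma affine_wleP w f :
  reflect (forall j, wlt (w - j.+1).+1 (diff j f)) (affine_wle w f).
Proof.
apply: (iffP idP) => [/supportedP wf j | wf].
  apply/supportedP => M /coef_diff_neq0[Mj /wf].
  rewrite weight_add1 // size_exp_add1 // => /orP[|]; first by lia.
  by rewrite ltnS leqn0 size_exp_eq0 => /eqP->; rewrite weight0.
apply/supportedP => L Lf; rewrite orbC -implyNb -ltnNge; apply/implyP => L2.
have [|j Lj] := @exp_neq0 L; first by rewrite -size_exp_eq0; lia.
have := wf j => /supportedP/(_ (L - axis j)); rewrite coef_diff_sub1 // => /(_ Lf).
have := weight_add1 (exp_sub1 Lj); rewrite subrK => ->.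
have := size_exp_add1 (exp_sub1 Lj); rewrite subrK => L2'.
by have := size_exp_le_weight (L - axis j); lia.
Qed.

Lemma affine_wle_ind (k : nat) w (K : fn -> Prop) :
    K 0 -> (forall f g, K f -> K g -> K (f + g)) ->
    (forall a f, K f -> K ([ffun=> a] * f)) ->
    (forall f, wlt w.+1 f -> supported (exp_before k) f -> K f) ->
    (forall j, (j < k)%N -> K (coord j)) ->
  forall f, affine_wle w f -> supported (exp_before k) f -> K f.
Proof.
move=> K0 KD KZ Kw KX f wf kf.
have : supported (fun L => ((weight L <= w)%N || (size_exp L <= 1)%N) && exp_before k L) f.
  by rewrite supportedI; apply/andP.
apply: supported_ind => // L /andP[] /orP[Lw | /size_exp_le1[-> | [j ->]]] Lk.
- by apply: Kw; apply: supported_binom.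
- by apply: Kw; apply: supported_binom; rewrite // weight0.
rewrite binom_axis; apply: KX; rewrite ltnNge; apply/negP => kj.
move/exp_beforeP/(_ j kj)/eqP: Lk; rewrite axisE eqxx; apply/negP.
exact: oner_neq0.
Qed.

Lemma affine_wle_pull (k : nat) w s f :
    (forall j, (j < k)%N -> wlt j.+2 (pull s (coord j))) ->
    (forall j, (j < k)%N -> affine_wle w (pull s (coord j))) ->
  supported (exp_before k) f -> affine_wle w f -> affine_wle w (pull s f).
Proof.
move=> sX sXw kf wf; move: f wf kf; apply: affine_wle_ind => [|f g|a f|f wf kf|].
- by rewrite pull0; apply: supported0.
- by rewrite pullD; apply: supportedD.
- by rewrite pullM pull_const; apply: supportedZ.
- by apply: wlt_affine; apply: wlt_pull kf _.
- exact: sXw.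
Qed.

Lemma affine_wle_pullB (k : nat) w s f :
    (forall j, wlt j.+1 (pull s (coord j) - coord j)) ->
    (forall j, (j < k)%N -> affine_wle w.-1 (pull s (coord j) - coord j)) ->
    supported (exp_before k) f ->
  affine_wle w f -> affine_wle w.-1 (pull s f - f).
Proof.
move=> sX sXw kf wf; move: f wf kf; apply: affine_wle_ind => [|f g|a f|f wf kf|].
- by rewrite pull0 subrr; apply: supported0.
- by rewrite pullD opprD addrACA; apply: supportedD.
- by rewrite pullM pull_const -mulrBr; apply: supportedZ.
- by apply: wlt_affine; apply: wlt_sub (wlt_pullB sX wf); lia.
- exact: sXw.
Qed.

(** * Detecting the weight by translations and shears *)

Definition shear i l (x : V) : V := x + x 0 i *: axis l.

Lemma shearE i l x j : shear i l x 0 j = x 0 j + x 0 i * (j == l)%:R.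
Proof. by rewrite 2!mxE axisE. Qed.

Lemma pull_shear_coord i l j :
  pull (shear i l) (coord j) - coord j = [ffun=> (j == l)%:R] * coord i.
Proof. by apply/ffunP => x; rewrite ffunM !ffunE shearE; ring. Qed.

Lemma diff_diffE i j f x : diff i (diff j f) x =
  f (x + axis i + axis j) - f (x + axis i) - f (x + axis j) + f x.
Proof. by rewrite !ffunE; ring. Qed.

Lemma pullBE s f x : (pull s f - f) x = f (s x) - f x.
Proof. by rewrite !ffunE. Qed.

(** Only a linear term [a * x_l] with [m <= l] could be too heavy.  Let [i] be
    the index before [l] and [u] the change of [f] under the shear [x_l + x_i]:
    the mixed difference of [u] along [i] and the first axis vanishes by its
    weight, and its value at the origin is [a].  This fails when [i] is itself
    the first axis, that is for [m = l = 1].  Then all second differences which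
    occur are constant, which leads to [2 a = 0]. *)
Lemma diff_first_wlt m f j0 : odd p -> (0 < m)%N -> j0 = 0%N :> nat ->
    (forall j, affine_wle m (diff j f)) ->
    (forall i l : 'I_n, l = i.+1 :> nat -> affine_wle m (pull (shear i l) f - f)) ->
  wlt m.+1 (diff j0 f).
Proof.
move=> p_odd m_gt0 j0_0 dfm ufm; apply: wlt_diff => l.
have /affine_wleP/(_ l) := dfm j0; set g := diff l _ => g_wlt.
have [lm | ml] := ltnP l m; first by apply: wlt_sub g_wlt; lia.
have /wlt1P g_const : wlt 1 g by apply: wlt_sub g_wlt; lia.
suff [x0 gx0] : exists x0, g x0 = 0.
  have -> : g = 0 by apply/ffunP => x; rewrite (g_const x x0) gx0 ffunE.
  exact: supported0.
have l_gt0 : (0 < l)%N by apply: leq_trans ml.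
have i_lt : (l.-1 < n)%N by rewrite prednK // ltnW.
pose i : 'I_n := Ordinal i_lt.
have il : l = i.+1 :> nat by rewrite /= prednK.
have li : (i == l) = false by rewrite -val_eqE /= il; lia.
have := ufm i l il; set u := pull _ f - f => /affine_wleP/(_ j0) u_wlt.
have [l_gt1 | l_le1] := ltnP 1 l.
  have ij0 : (i == j0) = false by rewrite -val_eqE /= j0_0; lia.
  have /(diff_wlt i) : wlt m (diff j0 u) by apply: wlt_sub u_wlt; lia.
  have -> : (m - i.+1 = 0)%N by lia.
  move=> /wlt0/ffunP/(_ 0); rewrite diff_diffE !pullBE !add0r [RHS]ffunE.
  have -> : shear i l (axis i + axis j0) = axis i + axis l + axis j0.
    by rewrite /shear mxE !axisE eqxx ij0 addr0 scale1r addrAC.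
  have -> : shear i l (axis i) = axis i + axis l by rewrite /shear axisE eqxx scale1r.
  have -> : shear i l (axis j0) = axis j0 by rewrite /shear axisE ij0 scale0r addr0.
  have -> : shear i l 0 = 0 by rewrite /shear mxE scale0r addr0.
  by move=> du0; exists (axis i); rewrite -[RHS]du0 diff_diffE; ring.
have j0i : j0 = i by apply: ord_inj; rewrite j0_0 /=; lia.
have m1 : m = 1%N by lia.
have /wlt1P du_const : wlt 1 (diff i u) by rewrite -j0i; apply: wlt_sub u_wlt; lia.
have /wlt1P dd_const : wlt 1 (diff l (diff l f)).
  by have /affine_wleP/(_ l) := dfm l; apply: wlt_sub; lia.
(* From here on only the plane spanned by the first two axes matters. *)
pose h (c d : 'F_p) := f (c *: axis i + d *: axis l).
have uE c d : u (c *: axis i + d *: axis l) = h c (d + c) - h c d.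
  rewrite pullBE /h /shear.
  have -> : (c *: axis i + d *: axis l) 0 i = c.
    by rewrite !mxE !eqxx li mulr1 mulr0 addr0.
  by rewrite -addrA -scalerDl.
have duE c d : diff i u (c *: axis i + d *: axis l) =
    h (c + 1) (d + (c + 1)) - h (c + 1) d - (h c (d + c) - h c d).
  have step : c *: axis i + d *: axis l + axis i = (c + 1) *: axis i + d *: axis l.
    by rewrite addrAC scalerDl scale1r.
  by rewrite ffunE step !uE.
have ddE c d : diff l (diff l f) (c *: axis i + d *: axis l) =
    h c (d + 1 + 1) - h c (d + 1) - h c (d + 1) + h c d.
  have step e : c *: axis i + e *: axis l + axis l = c *: axis i + (e + 1) *: axis l.
    by rewrite -addrA scalerDl scale1r.
  by rewrite diff_diffE !step.
have e1 := du_const (0 *: axis i + 0 *: axis l) (0 *: axis i + 1 *: axis l).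
have e2 := du_const (0 *: axis i + 0 *: axis l) (1 *: axis i + 0 *: axis l).
have e3 := dd_const (1 *: axis i + 0 *: axis l) ((1 + 1) *: axis i + 0 *: axis l).
have two_neq0 : 1 + 1 != 0 :> 'F_p.
  rewrite -[1 + 1]/(2%:R) Fp_eq0 (nat_of_Fp p_prime) -/(_ %| _)%N.
  by rewrite dvdn_prime2 //; apply: contraTneq p_odd => ->.
exists (1 *: axis i + 0 *: axis l); apply: (mulfI two_neq0); rewrite mulr0.
have -> : g (1 *: axis i + 0 *: axis l) =
    h (1 + 1) 1 - h 1 1 - h (1 + 1) 0 + h 1 0.
  rewrite /g j0i diff_diffE /h !scale0r !scalerDl !scale1r !addr0.
  by rewrite [axis i + axis l + _]addrAC; ring.
move: e1 e2 e3; rewrite !duE !ddE !add0r !addr0 => e1 e2 e3.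
have comb (A B C D E F y z : 'F_p) : A - B - (z - z) = C - A - (y - y) ->
    A - B - (z - z) = D - E - (A - B) -> C - A - A + B = D - F - F + E ->
  (1 + 1) * (F - A - E + B) = 0.
  rewrite !subrr !subr0 => h1 h2 h3.
  have -> : (1 + 1) * (F - A - E + B) = (C - A - A + B - (D - F - F + E)) +
    (A - B - (C - A)) - (A - B - (D - E - (A - B))) by ring.
  by rewrite h3 -h1 -h2 !subrr addr0 subr0.
exact: comb e1 e2 e3.
Qed.

(** The shear [x_l + x_i], for [l] the successor of [i], and the translation
    along [i] have the translation along [l] as their commutator.  Hence the
    difference of [f] along [l] is, up to a substitution which raises no weight,
    [diff i u - (v o shear - v)] with [u] the change of [f] under the shear and
    [v] the difference of [f] along [i].  The bound on [v o shear - v] is smaller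
    by one than that on [v], and one is what the weight gains from [i] to [l]. *)
Lemma affine_wle_succ m f : odd p -> (0 < m)%N ->
    (forall j, affine_wle m (diff j f)) ->
    (forall i l : 'I_n, l = i.+1 :> nat -> affine_wle m (pull (shear i l) f - f)) ->
  affine_wle m.+1 f.
Proof.
move=> p_odd m_gt0 dfm ufm; apply/affine_wleP => l; rewrite subSS.
move El : (nat_of_ord l) => N; elim: N l El => [|N IHN] l lN.
  by rewrite subn0; apply: diff_first_wlt.
have i_lt : (N < n)%N by rewrite (leq_trans _ (ltn_ord l)) // lN.
pose i : 'I_n := Ordinal i_lt.
have il : l = i.+1 :> nat by rewrite lN.
have li : (i == l) = false by rewrite -val_eqE /= il; lia.
have v_wlt : wlt (m - N).+1 (diff i f) by apply: IHN.
set z := diff l f; set v := diff i f in v_wlt; pose u := pull (shear i l) f - f.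
pose s x := shear i l x + axis i.
have zE : pull s z = diff i u - (pull (shear i l) v - v).
  apply/ffunP => x; rewrite !ffunE.
  have -> : shear i l (x + axis i) = s x + axis l.
    apply/rowP => j; rewrite /s !(shearE, mxE) !eqxx /= mulrDl mul1r; ring.
  by rewrite /s; ring.
pose s' (y : V) := y - axis i - (y 0 i - 1) *: axis l.
have -> : z = pull s' (pull s z).
  apply/ffunP => y; rewrite !ffunE; congr (f (_ + _) - f _);
  apply/rowP => j; rewrite /s /s' !(shearE, mxE) !eqxx ?li /=; ring.
apply: (@wlt_pull n) => [j _||]; first 1 last.
- exact: exp_beforeT.
- rewrite zE; apply: supportedB.
    have /affine_wleP/(_ i) := ufm i l il; exact: wlt_sub.
  apply: wlt_sub (wlt_pullB _ v_wlt) => [|j]; first by lia.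
  rewrite pull_shear_coord; have [-> | _] := eqVneq j l.
    by apply: supportedZ; apply: wlt_sub (wlt_coord i); rewrite il.
  have -> : [ffun=> 0] * coord i = 0 :> fn by apply/ffunP => x; rewrite ffunM !ffunE mul0r.
  exact: supported0.
have -> : pull s' (coord j) =
    coord j - [ffun=> (j == i)%:R] - [ffun=> (j == l)%:R] * (coord i - [ffun=> 1]).
  apply/ffunP => x; rewrite !(ffunE, ffunM) /s' !mxE eqxx /=; ring.
apply: supportedB.
  by apply: supportedB; [apply: wlt_coord | apply: wlt_const].
have [-> | _] := eqVneq j l; last first.
  have -> : [ffun=> 0] * (coord i - [ffun=> 1]) = 0 :> fn.
    by apply/ffunP => x; rewrite ffunM !ffunE mul0r.
  exact: supported0.
apply: supportedZ; apply: supportedB; last exact: wlt_const.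
by apply: wlt_sub (wlt_coord i); lia.
Qed.

(** * Triangular permutations *)

Implicit Types (s t : {perm V}).

Definition disp s k : fn := [ffun x : V => s x 0 k - x 0 k].

Lemma permE_disp s x k : s x 0 k = x 0 k + disp s k x.
Proof. by rewrite ffunE addrC subrK. Qed.

Lemma pull_coord s k : pull s (coord k) = coord k + disp s k.
Proof. by apply/ffunP => x; rewrite !ffunE addrC subrK. Qed.

Lemma pull_coordB s k : pull s (coord k) - coord k = disp s k.
Proof. by rewrite pull_coord addrC addKr. Qed.

Lemma dispM s t k : disp (s * t) k = disp s k + pull s (disp t k).
Proof. by apply/ffunP => x; rewrite !ffunE permM; ring. Qed.

Lemma disp1 k : disp 1 k = 0.
Proof. by apply/ffunP => x; rewrite !ffunE perm1 subrr. Qed.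

Lemma perm_disp_eq0 s : (forall k, disp s k = 0) -> s = 1%g.
Proof.
move=> s0; apply/permP => x; rewrite perm1; apply/rowP => k.
by rewrite permE_disp s0 ffunE addr0.
Qed.

Definition triangular_set : {set {perm V}} :=
  [set s | [forall k : 'I_n, supported (exp_before k) (disp s k)]].

Lemma triangularP s : reflect (forall k, supported (exp_before k) (disp s k))
  (s \in triangular_set).
Proof. by rewrite inE; apply: forallP. Qed.

Lemma triangular_agree (k : nat) s x y : s \in triangular_set ->
    (forall j : 'I_n, (j < k)%N -> x 0 j = y 0 j) ->
  forall j : 'I_n, (j < k)%N -> s x 0 j = s y 0 j.
Proof.
move=> /triangularP st xy j jk; rewrite !permE_disp xy //; congr (_ + _).
by apply: (supported_beforeP _ _ (st j)) => i ij; apply: xy; apply: ltn_trans jk.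
Qed.

Lemma triangular_pull (k : nat) s f : s \in triangular_set ->
  supported (exp_before k) f -> supported (exp_before k) (pull s f).
Proof.
move=> st kf; apply/supported_beforeP => x y xy; rewrite !ffunE.
by apply: (supported_beforeP _ _ kf) => j; apply: triangular_agree.
Qed.

Lemma triangular_group_set : group_set triangular_set.
Proof.
apply/group_setP; split=> [|s t st tt].
  by apply/triangularP => k; rewrite disp1 supported0.
apply/triangularP => k; rewrite dispM; apply: supportedD.
  by move/triangularP: st.
by apply: triangular_pull st _; move/triangularP: tt.
Qed.

Canonical triangular : {group {perm V}} := Group triangular_group_set.

Lemma disp_base_perm k (f : {ffun 'rV['F_p]_k -> 'F_p}) l x :
  disp (base_perm f) l x = - (l == k)%:R * f (before k x).
Proof. by rewrite ffunE permE /base_fun !mxE eqxx /=; ring. Qed.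

Lemma base_perm_triangular k (f : {ffun 'rV['F_p]_k -> 'F_p}) :
  base_perm f \in triangular_set.
Proof.
apply/triangularP => l; apply/supported_beforeP => x y xy.
rewrite !disp_base_perm; have [lk | _] := eqVneq l k; last by rewrite oppr0 !mul0r.
suff -> : before k x = before k y by [].
by apply/rowP => j; rewrite !mxE; apply: xy; rewrite lk /=.
Qed.

(** A triangular permutation is decomposed from the last coordinate on: the
    displacement of this coordinate can be cancelled by an element of its base
    group without affecting the others. *)
Lemma wreath_triangular : wreath p n = triangular.
Proof.
apply/val_inj/eqP; rewrite /= eqEsubset gen_subG; apply/andP; split.
  apply/bigcupsP => k _; apply/subsetP => _ /imsetP[f _ ->].
  exact: base_perm_triangular.
apply/subsetP => s st.
suff gen (N : nat) : (N <= n)%N -> forall s, s \in triangular_set ->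
    (forall k : 'I_n, (N <= k)%N -> disp s k = 0) -> s \in wreath p n.
  by apply: gen (leqnn n) _ st _ => k; rewrite leqNgt ltn_ord.
elim: N => [_ t _ t0 | N IHN Nn t tt tN].
  by rewrite (perm_disp_eq0 (fun k => t0 k (leq0n k))) group1.
pose k : 'I_n := Ordinal Nn.
(* Pads with zeros: a function of the first [k] coordinates is turned into an
   element of the base group by evaluating it at padded points. *)
pose ext (y : 'rV['F_p]_k) : V :=
  \row_i (if insub (nat_of_ord i) is Some j then y 0 j else 0).
pose b := base_perm [ffun y => disp t k (ext y)].
have bw : b \in wreath p n.
  by apply: mem_gen; apply/bigcupP; exists k => //; apply: imset_f.
rewrite -(groupMl _ bw); have bt := base_perm_triangular [ffun y => disp t k (ext y)].
apply: IHN (ltnW Nn) _ _ _ => [|l]; first exact: (groupM bt tt).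
rewrite leq_eqVlt => /orP[/eqP lk | Nl]; apply/ffunP => x; last first.
  rewrite dispM tN // pull0 addr0 disp_base_perm -val_eqE /= gtn_eqF //.
  by rewrite oppr0 mul0r ffunE.
have {l lk} -> : l = k by apply: val_inj.
rewrite dispM [LHS]ffunE [X in _ + X]ffunE [RHS]ffunE disp_base_perm eqxx ffunE.
have td := supported_beforeP _ _ (triangularP _ tt k).
have -> : disp t k (ext (before k x)) = disp t k x.
  by apply: td => j jk; rewrite mxE insubT /= mxE; congr (x _ _); apply: val_inj.
have -> : disp t k (b x) = disp t k x.
  apply: td => j jk; rewrite permE_disp disp_base_perm -val_eqE /= ltn_eqF //.
  by rewrite oppr0 mul0r addr0.
by rewrite mulN1r addNr.
Qed.

(** * The groups of the chain *)

(** For [0 < m <= n] this will be the [m]-th group of the chain.  The truncated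
    subtraction is meant: low components consist of affine functions. *)
Definition level_set (m : nat) : {set {perm V}} :=
  [set s in triangular |
    [forall k : 'I_n, affine_wle (m + k.+1 - n) (disp s k)]].

Lemma levelP m s : reflect (s \in triangular_set /\
    forall k : 'I_n, affine_wle (m + k.+1 - n) (disp s k)) (s \in level_set m).
Proof.
by rewrite [X in reflect _ X]in_set; apply: (iffP andP) => -[st sm]; split=> //;
  apply/forallP.
Qed.

Lemma level_sub m m' : (m <= m')%N -> level_set m \subset level_set m'.
Proof.
move=> mm; apply/subsetP => s /levelP[st sm]; apply/levelP; split=> // k.
by apply: affine_wle_sub (sm k); lia.
Qed.

Lemma affine_wlt (k w c : nat) f : (k <= c)%N -> (w <= c)%N ->
  supported (exp_before k) f -> affine_wle w f -> wlt c.+1 f.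
Proof.
move=> kc wc kf wf; move: f wf kf; apply: affine_wle_ind => [|f g|a f|f wf _|j jk].
- exact: supported0.
- exact: supportedD.
- exact: supportedZ.
- exact: wlt_sub wf.
- by apply: wlt_sub (wlt_coord j); lia.
Qed.

Lemma level_disp_wlt m c s k :
  s \in level_set m -> (k <= c)%N -> (m + k.+1 - n <= c)%N ->
  wlt c.+1 (disp s k).
Proof.
by move=> /levelP[/triangularP st sm] kc mc; apply: affine_wlt kc mc (st k) (sm k).
Qed.

(** The elements of [level_set m'.+1] preserve the spaces of components which
    define [level_set m']: a function in the space of index [k] only sees the
    displacements of the coordinates before [k], and each of these is bounded
    at level [m'.+1] as the [k]-th is at level [m']. *)
Lemma level_pull m m' s k f : (m <= n)%N -> (m <= m'.+1)%N ->
    (forall j, (j < k)%N -> affine_wle (m + j.+1 - n) (disp s j)) ->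
    s \in triangular_set ->
    supported (exp_before k) f -> affine_wle (m' + k.+1 - n) f ->
  affine_wle (m' + k.+1 - n) (pull s f).
Proof.
move=> mn mm' sm /triangularP st kf wf.
apply: affine_wle_pull kf wf => j jk; rewrite pull_coord; apply: supportedD.
- exact: wlt_coord.
- by apply: affine_wlt (st j) (sm j jk); lia.
- exact: affine_wle_coord.
- by apply: affine_wle_sub (sm j jk); lia.
Qed.

Lemma level_group_set m : (m <= n)%N -> group_set (level_set m).
Proof.
move=> mn; apply/group_setP; split=> [|s t sl tl].
  apply/levelP; split=> [|k]; first exact: group1.
  by rewrite disp1; apply: supported0.
have [st sm] := levelP _ _ sl; have [tt tm] := levelP _ _ tl.
apply/levelP; split=> [|k]; first exact: (groupM st tt).
rewrite dispM; apply: affine_wleD => //.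
by apply: (@level_pull m) => //; move/triangularP: tt; apply.
Qed.

Lemma level_invg m s : (m <= n)%N -> s \in level_set m -> s^-1%g \in level_set m.
Proof. by move=> mn; rewrite -[level_set m]/(gval (Group (level_group_set mn))) groupV. Qed.

(** The displacements of [t ^ s] are the functions
    [disp t k + (disp s k o t - disp s k)] read at the inverse of [s], and
    substituting [t] changes [disp s k] by a function lighter by one. *)
Lemma level_norm m : (m < n)%N -> level_set m.+1 \subset 'N(level_set m)%g.
Proof.
move=> mn; apply/subsetP => s sl; rewrite inE; apply/subsetP => _ /imsetP[t tl ->].
have [st sm] := levelP _ _ sl; have [tt tm] := levelP _ _ tl.
have [sVt sVm] := levelP _ _ (level_invg mn sl).
apply/levelP; split=> [|k]; first exact: (groupJ tt st).
have -> : disp (t ^ s)%g k =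
    pull s^-1%g (disp t k + (pull t (disp s k) - disp s k)).
  apply/ffunP => x; rewrite !ffunE conjgE !permM permKV; ring.
apply: (@level_pull m.+1) => //.
  apply: supportedD; first by move/triangularP: tt; apply.
  apply: supportedB; last by move/triangularP: st; apply.
  by apply: triangular_pull => //; move/triangularP: st; apply.
apply: affine_wleD => //.
have -> : (m + k.+1 - n = (m.+1 + k.+1 - n).-1)%N by lia.
apply: (@affine_wle_pullB k) (sm k) => [j|j jk|]; rewrite ?pull_coordB.
- by apply: level_disp_wlt tl _ _ => //; lia.
- by apply: affine_wle_sub (tm j); lia.
- by move/triangularP: st; apply.
Qed.

Definition translation (v : V) : {perm V} := perm (addIr v).

Lemma disp_translation v k : disp (translation v) k = [ffun=> v 0 k].
Proof. by apply/ffunP => x; rewrite !ffunE permE mxE; ring. Qed.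

Lemma translation_level m v : translation v \in level_set m.
Proof.
apply/levelP; split=> [|k]; last first.
  by rewrite disp_translation; apply: wlt_affine; apply: wlt_const.
apply/triangularP => k; rewrite disp_translation; apply/supported_beforeP => x y _.
by rewrite !ffunE.
Qed.

Lemma shear_inj (i l : 'I_n) : i != l -> injective (shear i l).
Proof.
move=> /negPf il x y xy; have /rowP/(_ i) := xy.
rewrite !shearE il !mulr0 !addr0 => xyi.
by move: xy; rewrite /shear xyi => /addIr.
Qed.

Lemma shear_level (m : nat) (i l : 'I_n) : (i < l)%N ->
  exists2 s : {perm V}, s =1 shear i l & s \in level_set m.
Proof.
move=> il; have nil : i != l by rewrite -val_eqE /= ltn_eqF.
exists (perm (shear_inj nil)) => [x|]; first by rewrite permE.
have dE k : disp (perm (shear_inj nil)) k = [ffun=> (k == l)%:R] * coord i.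
  by apply/ffunP => x; rewrite ffunM !ffunE permE shearE; ring.
apply/levelP; split=> [|k]; last first.
  by rewrite dE; apply: supportedZ; apply: affine_wle_coord.
apply/triangularP => k; apply/supported_beforeP => x y xy.
rewrite dE !ffunM !ffunE; have [kl | _] := eqVneq k l; last by rewrite !mul0r.
by rewrite xy // kl.
Qed.

(** A shear from [k] to the next coordinate reads off the coordinate [k]:
    conjugated by the inverse of [s], it moves the next coordinate by the [k]-th
    coordinate of [s x]. *)
Lemma normalizer_level_lt m s k : s \in triangular_set ->
    s \in 'N(level_set m)%g -> (k.+1 < n)%N ->
  affine_wle (m.+1 + k.+1 - n) (disp s k).
Proof.
move=> st sN kn; pose l : 'I_n := Ordinal kn.
have [e eE el] := shear_level m (ltnSn k : (k < l)%N).
have sVt : s^-1%g \in triangular_set by rewrite groupV.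
have /levelP[_ /(_ l)] : (e ^ s^-1)%g \in level_set m by rewrite memJ_norm ?groupV.
have -> : disp (e ^ s^-1)%g l = pull s (coord k).
  apply/ffunP => x; rewrite !ffunE conjgE invgK !permM eE.
  have := permE_disp s^-1%g (shear k l (s x)) l.
  have := permE_disp s^-1%g (s x) l; rewrite permK.
  have -> : disp s^-1%g l (shear k l (s x)) = disp s^-1%g l (s x).
    apply: (supported_beforeP _ _ (triangularP _ sVt l)) => j jl.
    by rewrite shearE -val_eqE /= ltn_eqF // mulr0 addr0.
  by move=> -> ->; rewrite shearE eqxx mulr1; ring.
rewrite pull_coord => sl; rewrite -[disp s k](addKr (coord k)) addrC.
have -> : (m.+1 + k.+1 - n = m + l.+1 - n)%N by rewrite /=; lia.
by apply: supportedB => //; apply: affine_wle_coord.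
Qed.

Lemma normalizer_level m : odd p -> (0 < m)%N -> (m < n)%N ->
  'N_triangular(level_set m)%g = level_set m.+1.
Proof.
move=> p_odd m_gt0 mn; apply/eqP; rewrite eqEsubset subsetI level_norm //.
rewrite andbT andbC; apply/andP; split.
  by apply/subsetP => s /levelP[].
apply/subsetP => s /setIP[st sN]; apply/levelP; split=> // k.
have sm j : (j.+1 < n)%N -> affine_wle (m.+1 + j.+1 - n) (disp s j).
  exact: normalizer_level_lt.
have [/sm // | nk] := ltnP k.+1 n.
have kn : k.+1 = n by apply/eqP; rewrite eqn_leq nk ltn_ord.
have sk := triangularP _ st k; set f := disp s k in sk *.
have change e : e \in level_set m -> disp e k = 0 -> affine_wle m (pull e f - f).
  move=> el ek; have -> : pull e f - f = pull s (disp (e ^ s)%g k).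
    apply/ffunP => x; rewrite !ffunE conjgE !permM permK.
    have := permE_disp e x k; rewrite ek ffunE addr0 => ->; ring.
  have /levelP[est esm] : (e ^ s)%g \in level_set m by rewrite memJ_norm.
  have {1}-> : m = (m + k.+1 - n)%N by lia.
  apply: (@level_pull m.+1) => // [j jk|]; last by move/triangularP: est; apply.
  by apply: sm; rewrite -[ltnRHS]kn ltnS.
have fk x y : (forall j : 'I_n, (j < k)%N -> x 0 j = y 0 j) -> f x = f y.
  exact: (supported_beforeP _ _ sk).
have -> : (m.+1 + k.+1 - n = m.+1)%N by lia.
apply: affine_wle_succ => // [j|i l il].
  have [-> | jk] := eqVneq j k.
    have -> : diff k f = 0; last exact: supported0.
    apply/ffunP => x; rewrite [LHS]ffunE [RHS]ffunE.
    apply/eqP; rewrite subr_eq0; apply/eqP.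
    by apply: fk => i ik; rewrite mxE axisE -val_eqE /= ltn_eqF // addr0.
  have -> : diff j f = pull (translation (axis j)) f - f.
    by apply/ffunP => x; rewrite pullBE [LHS]ffunE permE.
  apply: change; first exact: translation_level.
  by rewrite disp_translation axisE eq_sym (negPf jk).
have [lk | lk] := eqVneq l k.
  have -> : pull (shear i l) f - f = 0; last exact: supported0.
  apply/ffunP => x; rewrite pullBE [RHS]ffunE.
  apply/eqP; rewrite subr_eq0; apply/eqP.
  by apply: fk => j jk; rewrite shearE lk -val_eqE /= ltn_eqF // mulr0 addr0.
have [|e eE el] := @shear_level m i l; first by rewrite il.
have -> : pull (shear i l) f - f = pull e f - f.
  by apply/ffunP => x; rewrite !pullBE eE.
apply: change => //; apply/ffunP => x.
by rewrite [LHS]ffunE [RHS]ffunE eE shearE eq_sym (negPf lk) mulr0 addr0 subrr.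
Qed.

Lemma translationE v x : translation v x = x + v.
Proof. exact: permE. Qed.

Lemma translationD u v : translation (u + v) = (translation u * translation v)%g.
Proof. by apply/permP => x; rewrite permM !permE addrA. Qed.

Lemma translationN v : translation (- v) = (translation v)^-1%g.
Proof.
apply/eqP; rewrite eq_sym eq_invg_mul -translationD subrr; apply/eqP/permP => x.
by rewrite permE perm1 addr0.
Qed.

Lemma Delta_translation k : Delta p k = translation (- axis k).
Proof. by apply/permP => x; rewrite !permE /base_fun ffunE scale1r. Qed.

Lemma translationsE : translations p n = [set translation v | v : V] :> {set _}.
Proof.
apply/eqP; rewrite eqEsubset; apply/andP; split.
  have tg : group_set [set translation v | v : V].
    apply/group_setP; split=> [|_ _ /imsetP[u _ ->] /imsetP[v _ ->]].
      apply/imsetP; exists 0 => //.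
      by apply/permP => x; rewrite perm1 permE addr0.
    by rewrite -translationD imset_f.
  rewrite -[[set translation v | v : V]]/(gval (Group tg)) gen_subG.
  by apply/subsetP => _ /imsetP[k _ ->]; rewrite Delta_translation imset_f.
apply/subsetP => _ /imsetP[v _ ->]; rewrite (row_sum_delta v).
elim/big_ind: _ => [|u u' uT uT'|k _]; last first.
- rewrite -[v 0 k]opprK -(Fp_natr (- v 0 k)) scaleNr scaler_nat -mulNrn.
  elim: (nat_of_ord _) => [|c IHc].
    by rewrite mulr0n -(subrr 0) translationD translationN mulgV group1.
  rewrite mulrS translationD groupM //; apply: mem_gen; apply/imsetP; exists k => //.
  by rewrite Delta_translation.
- by rewrite translationD groupM.
- by rewrite -(subrr 0) translationD translationN mulgV group1.
Qed.

(** Normalizing the translations means having constant differences, that is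
    being affine; and weight at most 1, which [level_set 1] allows to the last
    component, is affine as well. *)
Lemma normalizer_translations : 'N_triangular(translations p n)%g = level_set 1.
Proof.
apply/eqP; rewrite eqEsubset subsetI; apply/and3P; split.
- apply/subsetP => s /setIP[st sN]; apply/levelP; split=> // k.
  apply/affine_wleP => j; apply: wlt_sub (_ : wlt 1 _) => //.
  have : (translation (axis j) ^ s)%g \in translations p n.
    by rewrite memJ_norm // translationsE imset_f.
  rewrite translationsE => /imsetP[v _ ev].
  apply/wlt1P => x y.
  have E z : diff j (disp s k) z = v 0 k - axis j 0 k.
    have /permP/(_ (s z)) := ev; rewrite conjgE !permM permK !permE => sv.
    by rewrite !ffunE sv !mxE; ring.
  by rewrite !E.
- by apply/subsetP => s /levelP[].
apply/subsetP => s /levelP[st sm]; rewrite inE -genJ gen_subG.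
apply/subsetP => _ /imsetP[_ /imsetP[j _ ->] ->].
rewrite Delta_translation translationN conjVg groupV translationsE; apply/imsetP.
exists (\row_k (axis j 0 k + diff j (disp s k) 0)) => //.
apply/permP => x; rewrite conjgE !permM !translationE.
apply/rowP => k; rewrite [RHS]mxE [X in _ = _ + X]mxE.
have /affine_wleP/(_ j) := sm k => sj.
have /wlt1P/(_ 0 (s^-1%g x)) -> : wlt 1 (diff j (disp s k)).
  by apply: wlt_sub sj; have := ltn_ord k; lia.
rewrite [diff _ _ _]ffunE ![disp s k _]ffunE permKV [(_ + axis j)%R 0 k]mxE; ring.
Qed.

Lemma normalizer_chain_level m : odd p -> (0 < m)%N -> (m <= n)%N ->
  normalizer_chain p n m = level_set m :> {set _}.
Proof.
move=> p_odd; elim: m => // -[_ _ _|m IHm _ mn].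
  rewrite -[LHS]/('N_(wreath p n)(translations p n))%g.
  by rewrite wreath_triangular normalizer_translations.
rewrite -[LHS]/('N_(wreath p n)(normalizer_chain p n m.+1))%g IHm ?(ltnW mn) //.
by rewrite wreath_triangular normalizer_level.
Qed.

(** * Counting *)

Definition level_exps (m : nat) : {set 'I_n * V} :=
  [set q : 'I_n * V | exp_before q.1 q.2 &&
    ((weight q.2 <= m + q.1.+1 - n)%N || (size_exp q.2 <= 1)%N)].

Lemma triangular_perm (f : 'I_n -> fn) :
  (forall k : 'I_n, supported (exp_before k) (f k)) -> exists s, forall k, disp s k = f k.
Proof.
move=> ft; have inj : injective (fun x => x + \row_k f k x).
  move=> x y xy; suff xyN (N : nat) : forall j : 'I_n, (j < N)%N -> x 0 j = y 0 j.
    by apply/rowP => j; apply: (xyN n).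
  elim: N => // N IHN j; rewrite ltnS leq_eqVlt => /orP[/eqP jN | /IHN//].
  have /rowP/(_ j) := xy; rewrite !mxE.
  by rewrite (supported_beforeP _ _ (ft j) x y) ?jN // => /addIr.
by exists (perm inj) => k; apply/ffunP => x; rewrite ffunE permE !mxE; ring.
Qed.

(** A choice of coefficients on the allowed exponents is the same as a choice of
    the components, and each choice of components gives a permutation. *)
Lemma card_level m : #|level_set m| = (p ^ #|level_exps m|)%N.
Proof.
pose c s : {ffun 'I_n * V -> 'F_p} := [ffun q : 'I_n * V => coef (disp s q.1) q.2].
have c_inj : injective c.
  move=> s t /ffunP st; apply/permP => x; apply/rowP => k.
  rewrite !permE_disp; congr (_ + _); apply: (congr1 (fun f : fn => f x)).
  apply: (can_inj coefK); apply/ffunP => L.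
  by have := st (k, L); rewrite !ffunE.
rewrite -(card_imset _ c_inj).
have -> : (p ^ #|level_exps m|)%N = #|pffun_on (0 : 'F_p) (level_exps m) 'F_p|.
  by rewrite card_pffun_on card_Fp.
apply: eq_card => d; apply/imsetP/pffun_onP => [[s /levelP[st sm] ->] | [dA _]].
  split=> [|a _] //; apply/supportP => -[k L] kL.
  rewrite ffunE /=; apply: contraNeq kL => Lf; rewrite inE /=.
  move/triangularP/(_ k)/supportedP/(_ L Lf): st => /= ->.
  by have /supportedP := sm k => ->.
pose f k : fn := newton [ffun L => d (k, L)].
have fA k L : coef (f k) L != 0 -> (k, L) \in level_exps m.
  by rewrite newtonK ffunE => dn0; apply: (subsetP dA); rewrite inE.
have [|s sf] := @triangular_perm f.
  by move=> k; apply/supportedP => L /fA; rewrite inE => /andP[].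
exists s; last by apply/ffunP => -[k L]; rewrite !ffunE /= sf newtonK ffunE.
apply/levelP; split=> [|k].
  by apply/triangularP => k; rewrite sf; apply/supportedP => L /fA; rewrite inE => /andP[].
by rewrite sf; apply/supportedP => L /fA; rewrite inE => /andP[].
Qed.

(** An exponent [L] with at least two factors enters the component [k] at the
    step to [m.+1] exactly when [weight L + n = m + k.+2], and then it involves
    only coordinates before [k].  So the projection to [L] is injective on the
    new pairs. *)
Lemma card_level_exps m : (0 < m)%N -> (m < n)%N ->
  #|level_exps m.+1| = (#|level_exps m| +
    #|[set L : V | (1 < size_exp L)%N && (weight L <= m.+1)%N]|)%N.
Proof.
move=> m_gt0 mn; have sub : level_exps m \subset level_exps m.+1.
  apply/subsetP => q; rewrite !inE => /andP[-> /orP[qm | ->]]; last by rewrite orbT.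
  by rewrite (leq_trans qm) //; lia.
rewrite -(cardsID (level_exps m)) (setIidPr sub); congr addn.
have newE q : q \in level_exps m.+1 :\: level_exps m =
    [&& exp_before q.1 q.2, (1 < size_exp q.2)%N & (weight q.2 + n == m + q.1.+2)%N].
  rewrite !inE; case: (exp_before _ _) => //=; have := size_exp_le_weight q.2.
  by have := ltn_ord q.1; move: (weight _) (size_exp _) (nat_of_ord _) => a b c; lia.
rewrite -(card_in_imset (f := snd)) => [|[k L] [k' L']]; last first.
  rewrite !newE /= => /and3P[_ _ /eqP wL] /and3P[_ _ /eqP wL'] LL'.
  rewrite LL' in wL *; congr (_, _); apply: ord_inj; lia.
apply: eq_card => L; rewrite [RHS]inE; apply/imsetP/andP => [[[k L'] + ->] | [L2 Lm]].
  rewrite newE /= => /and3P[_ L2 /eqP wL]; split=> //.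
  by have := ltn_ord k; lia.
have wL2 : (1 < weight L)%N by apply: leq_trans (size_exp_le_weight L).
have kn : (weight L + n - m.+2 < n)%N by lia.
exists (Ordinal kn, L) => //; rewrite newE /= L2 andTb; apply/andP; split; last by lia.
apply/exp_beforeP => j /= kj; apply/eqP; apply: contraT => Lj.
have := weight_add1 (exp_sub1 Lj); have := size_exp_add1 (exp_sub1 Lj).
rewrite subrK; have := size_exp_le_weight (L - axis j); move: kj L2.
move: (weight (L - _)) (size_exp (L - _)) => a b; clear - mn; lia.
Qed.

Lemma sum_count (h : nat -> nat) (r : seq nat) : all (fun a => 0 < a <= n)%N r ->
  (\sum_(j < n) h j.+1 * count_mem j.+1 r = \sum_(a <- r) h a)%N.
Proof.
elim: r => [_|a r IHr /= /andP[/andP[a0 an] /IHr IH]].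
  by rewrite big_nil big1 // => j _; rewrite muln0.
rewrite big_cons -IH; under eq_bigr do rewrite mulnDr.
rewrite big_split /=; congr addn.
have a1n : (a.-1 < n)%N by rewrite prednK.
rewrite (bigD1 (Ordinal a1n)) //= prednK // eqxx muln1 big1 ?addn0 // => j ja.
rewrite (_ : (a == j.+1) = false) ?muln0 //.
by apply: contraNF ja => /eqP aj; apply/eqP/val_inj; rewrite /= aj.
Qed.

Lemma partition_parts w r : is_partition w r -> (w <= n)%N ->
  all (fun a => 0 < a <= n)%N r.
Proof.
case/and3P => _ r0 /eqP sw wn; apply/allP => a as_; apply/andP; split.
  by rewrite lt0n; apply: contraNneq r0 => <-.
by apply: leq_trans wn; rewrite -sw (perm_sumn (perm_to_rem as_)) /= leq_addr.
Qed.

Lemma t_numE w : (w <= n)%N ->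
  t_num p w = #|[set L : V | (1 < size_exp L)%N && (weight L == w)]|.
Proof.
move=> wn; rewrite /t_num; set B := [set b | _].
pose parts (b : w.-bseq 'I_w.+1) := [seq val a | a <- b].
pose e (b : w.-bseq 'I_w.+1) : V := \row_(j < n) (count_mem j.+1 (parts b))%:R.
have eE b j : b \in B -> nat_of_ord (e b 0 j) = count_mem j.+1 (parts b).
  rewrite inE /= => /and3P[_ _ /allP bp]; rewrite mxE nat_of_Fp // modn_small //.
  have [jb | jb] := boolP (j.+1 \in parts b).
    by have := bp _ jb; have := prime_gt0 p_prime; rewrite /parts /=; lia.
  by rewrite (count_memPn jb) prime_gt0.
have partsP b : b \in B -> all (fun a => 0 < a <= n)%N (parts b).
  by rewrite inE => /and3P[bp _ _]; apply: partition_parts bp wn.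
rewrite -(card_in_imset (f := e)) => [|b b' bB b'B ebb']; last first.
  have : parts b = parts b'.
    have := bB; have := b'B; rewrite !inE => /and3P[/and3P[b's _ _] _ _].
    move=> /and3P[/and3P[bs _ _] _ _].
    apply: (sorted_eq _ _ bs b's) => [x y z xy yz|x y /andP[xy yx]|].
    - exact: leq_trans yz xy.
    - by apply/eqP; rewrite eqn_leq; apply/andP.
    apply/allP => a _; apply/eqP => /=.
    have [an | an] := boolP (0 < a <= n)%N; last first.
      rewrite !(count_memPn _) //; apply: contra an => ab.
        exact: (allP (partsP _ b'B)).
      exact: (allP (partsP _ bB)).
    have a1n : (a.-1 < n)%N by rewrite prednK; case/andP: an.
    have := eE b (Ordinal a1n) bB; rewrite ebb' eE //=.
    by rewrite prednK //; case/andP: an.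
  by move=> /(inj_map val_inj) => bb'; apply: val_inj.
apply: eq_card => L; rewrite [RHS]inE.
have sizeE b : b \in B -> size_exp (e b) = size (parts b).
  move=> bB; rewrite -sum1_size -(sum_count (fun=> 1%N) (partsP b bB)).
  by apply: eq_bigr => j _; rewrite eE // mul1n.
have weightE b : b \in B -> weight (e b) = sumn (parts b).
  move=> bB; rewrite sumnE -(sum_count id (partsP b bB)).
  by apply: eq_bigr => j _; rewrite eE.
apply/imsetP/andP => [[b bB ->] | [L2 /eqP Lw]].
  rewrite sizeE // weightE //; move: bB; rewrite inE => /and3P[/and3P[_ _ bw] b2 _].
  by split.
pose s0 := flatten [seq nseq (L 0 j) j.+1 | j <- enum 'I_n].
have countE j : count_mem (nat_of_ord j).+1 s0 = nat_of_ord (L 0 j).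
  rewrite count_flatten -map_comp sumnE big_map big_enum (bigD1 j) //=.
  rewrite count_nseq /= eqxx mul1n big1 ?addn0 // => i ij.
  by rewrite count_nseq /= eqSS val_eqE (negPf ij).
have s0P : all (fun a => 0 < a <= n)%N s0.
  apply/allP => a /flatten_mapP[j _]; rewrite mem_nseq => /andP[_ /eqP->] /=.
  exact: ltn_ord.
pose s := sort geq s0.
have ss0 : perm_eq s s0 by rewrite /s perm_sort.
have sP : is_partition w s.
  apply/and3P; split.
  - by apply: sort_sorted => x y; apply: leq_total.
  - by rewrite (perm_mem ss0); apply/negP => /(allP s0P).
  rewrite (perm_sumn ss0) sumnE -(sum_count id s0P) -Lw; apply/eqP.
  by apply: eq_bigr => j _; rewrite countE.
have [b bs] := partition_bseq sP.
have bB : b \in B.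
  rewrite inE /= bs sP /=; apply/andP; split.
    rewrite (perm_size ss0) -sum1_size -(sum_count (fun=> 1%N) s0P).
    apply: leq_trans L2 _; apply: eq_leq; apply: eq_bigr => j _.
    by rewrite countE mul1n.
  apply/allP => a as_; have /andP[a0 an] := allP (partition_parts sP wn) a as_.
  have a1n : (a.-1 < n)%N by rewrite prednK.
  rewrite (seq.permP ss0) -[a]prednK // -[a.-1]/(nat_of_ord (Ordinal a1n)) countE.
  by have := ltn_Fp p_prime (L 0 (Ordinal a1n)); lia.
exists b => //; apply/rowP => j; apply: ord_inj; rewrite eE // /parts bs.
by rewrite (seq.permP ss0) countE.
Qed.

Lemma q_numE w : (w <= n)%N ->
  q_num p w = #|[set L : V | (1 < size_exp L)%N && (weight L <= w)%N]|.
Proof.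
rewrite /q_num; elim: w => [_|w IHw wn].
  rewrite big_geq //; symmetry; apply: eq_card0 => L; rewrite !inE.
  by have := size_exp_le_weight L; move: (size_exp L) (weight L) => a b; lia.
rewrite big_nat_recr //= IHw ?(ltnW wn) // t_numE //.
rewrite -cardsUI [X in (_ + X)%N]eq_card0 ?addn0 => [|L]; last first.
  by rewrite !inE; move: (size_exp L) (weight L) => a b; lia.
by apply: eq_card => L; rewrite !inE; move: (size_exp L) (weight L) => a b; lia.
Qed.

Lemma card_normalizer_quotient m : odd p -> (0 < m)%N -> (m < n)%N ->
  #|(normalizer_chain p n m.+1 / normalizer_chain p n m)%g| = (p ^ q_num p m.+1)%N.
Proof.
move=> p_odd m_gt0 mn.
have Gm := normalizer_chain_level p_odd m_gt0 (ltnW mn).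
have GSm := normalizer_chain_level p_odd (ltn0Sn m) mn.
rewrite card_quotient; last by rewrite GSm Gm level_norm.
rewrite -divgS /= GSm Gm ?level_sub // !card_level card_level_exps // -q_numE //.
by rewrite expnD mulKn // expn_gt0 prime_gt0.
Qed.

End Newton.

Theorem theorem6p8 (p n i : nat) (p_prime : prime p) (p_odd : odd p)
    (n_gt0 : (0 < n)%N) (i_range : (1 <= i <= n - 1)%N) :
  #|(normalizer_chain p n i.+1 / normalizer_chain p n i)%g|
    = (p ^ q_num p i.+1)%N.
Proof.
by have /andP[i_gt0 i_lt] := i_range; apply: card_normalizer_quotient => //; lia.
Qed.
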